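(* Let $X$ be a nonempty set and let $m\in\mathbb{N}$. An $m$-bounded function $F\colon X^*\to X^*$ is associative if and only if the following conditions are satisfied. (a) $F\circ F_k=F_k$ for $k=0,\ldots,m+1$. (b) $F(x)=F(xF(\varepsilon))$ for all $x\in X$. (c) $F(F(x\mathbf{y})z)=F(xF(\mathbf{y}z))$ for all $x\in X$, $\mathbf{y}\in X^*$, and $z\in X$ such that $|x\mathbf{y}z|\leq m+2$. (d) Either $F(x_1\cdots x_n)=F(F(x_1\cdots x_{n-1})x_n)$ for all $n\geq 1$ and all $x_1,\ldots,x_n\in X$, or $F(x_1\cdots x_n)=F(F(\cdots F(F(\varepsilon)x_1)\cdots)x_n)$ for all $n\geq 1$ and all $x_1,\ldots,x_n\in X$.
   Context: $X^*=\bigcup_{n\geq 0}X^n$ is the free monoid of strings over $X$ (concatenation written as juxtaposition), with empty string $\varepsilon$; elements of $X$ are letters (strings of length 1), and $|\mathbf{x}|$ is the length of a string. $\mathbb{N}$ is the set of nonnegative integers. $F\colon X^*\to X^*$ is associative if $F(\mathbf{x}\mathbf{y}\mathbf{z})=F(\mathbf{x}F(\mathbf{y})\mathbf{z})$ for all $\mathbf{x},\mathbf{y},\mathbf{z}\in X^*$. $F_k$ denotes the restriction of $F$ to $X^k$. $F$ is $m$-bounded if $|F(\mathbf{x})|\leq m$ for every $\mathbf{x}\in X^*$. *)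

(* Defs.v *)
From mathcomp Require Import all_boot.

Set Implicit Arguments.
Unset Strict Implicit.
Unset Printing Implicit Defensive.

(* The free monoid of strings over X is [seq X], with
   concatenation [++]; the letter x, as a string of length 1, is [:: x]. *)

Definition string_associative (X : Type) (F : seq X -> seq X) : Prop :=
  forall x y z : seq X, F (x ++ y ++ z) = F (x ++ F y ++ z).

Definition string_bounded (X : Type) (m : nat) (F : seq X -> seq X) : Prop :=
  forall x : seq X, size (F x) <= m.

Definition string_restr (X : Type) (F : seq X -> seq X) (k : nat) :
    k.-tuple X -> seq X :=
  fun x => F x.
Arguments string_restr [X] F k _.

(* [iter_letters F [:: x_1; ...; x_n]] is F(F( ... F(F(eps)x_1) ... )x_n),
   and F eps when n = 0. *)
Definition iter_letters (X : Type) (F : seq X -> seq X) (s : seq X) : seq X :=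
  foldl (fun u x => F (u ++ [:: x])) (F [::]) s.

(* Main.v *)
(* Either form of (d) says F(sx) = F(F(s)x), which yields F(st) = F(F(s)t).
   For right absorption F(aw) = F(aF(w)) by a letter a, induct on w = yz: replacing y
   by F(y), of length at most m, brings ayz into the range where (c) applies. *)
Require Import Defs.
From mathcomp Require Import all_boot.

Section LeftAbsorption.

Variables (X : Type) (F : seq X -> seq X).
Hypothesis F_rcons : forall (s : seq X) (x : X), F (s ++ [:: x]) = F (F s ++ [:: x]).

(** A value F(sx) equals F(F(s)x), and F(s)x has length at most m+1, so idempotence on short strings
    already covers it. *)
Lemma idem_of_bounded (m : nat) (hF : string_bounded m F) :
  (forall s, size s <= m.+1 -> F (F s) = F s) -> forall s, F (F s) = F s.
Proof.
move=> idem_short; elim/last_ind => [|s x _]; first exact: idem_short.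
by rewrite -cats1 F_rcons idem_short // size_cat addn1 ltnS hF.
Qed.

Hypothesis F_idem : forall s, F (F s) = F s.

Lemma F_catl (s t : seq X) : F (s ++ t) = F (F s ++ t).
Proof.
elim/last_ind: t => [|t x IHt]; first by rewrite !cats0 F_idem.
by rewrite -cats1 !catA F_rcons IHt -F_rcons.
Qed.

(** By [F_catl] the suffix z can be stripped from both sides, leaving F(xy) = F(xF(y)); this follows
    by peeling off the letters of x one at a time, with idempotence as the base case. *)
Lemma associative_of_cons :
  (forall a w, F (a :: w) = F (a :: F w)) -> string_associative F.
Proof.
move=> F_cons x y z; rewrite !catA F_catl [RHS]F_catl; congr (F (_ ++ z)).
elim: x => [|a x IHx] /=; first by rewrite F_idem.
by rewrite F_cons IHx -F_cons.
Qed.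

End LeftAbsorption.

Theorem proposition2p8 (X : Type) (hX : inhabited X) (m : nat)
    (F : seq X -> seq X) (hF : string_bounded m F) :
  string_associative F <->
  [/\ (* (a) *)
      forall k : nat, k <= m.+1 ->
        F \o string_restr F k =1 string_restr F k,
      (* (b) *)
      forall x : X, F [:: x] = F ([:: x] ++ F [::]),
      (* (c) *)
      forall (x : X) (y : seq X) (z : X), size ([:: x] ++ y ++ [:: z]) <= m.+2 ->
        F (F ([:: x] ++ y) ++ [:: z]) = F ([:: x] ++ F (y ++ [:: z]))
    & (* (d) *)
      (forall (s : seq X) (x : X), F (s ++ [:: x]) = F (F s ++ [:: x])) \/
      (forall s : seq X, 0 < size s -> F s = iter_letters F s)].
Proof.
split=> [assoc | [idem_short F_letter F_swap F_left]].
  have F_left s t : F (s ++ t) = F (F s ++ t) by exact: (assoc [::]).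
  have F_right s t : F (s ++ t) = F (s ++ F t).
    by have := assoc s t [::]; rewrite !cats0.
  split=> [k _ x | x | x y z _ |].
  - exact/esym/(F_right [::]).
  - exact: F_right [:: x] [::].
  - by rewrite -F_left -F_right catA.
  - by left=> s x; exact: F_left.
have F_rcons s x : F (s ++ [:: x]) = F (F s ++ [:: x]).
  case: F_left => [//|F_iter].
  (* The fold starts at F(eps), so the iterated form also holds for n = 0; this covers an empty s
     below, where the last fold step is split off. *)
  have F_iter0 t : F t = iter_letters F t by case: t => [//|a t]; exact: F_iter.
  by rewrite F_iter0 /iter_letters foldl_cat /= -/(iter_letters F s) -F_iter0.
have F_idem : forall s, F (F s) = F s.
  apply: (idem_of_bounded _ _ F_rcons _ hF) => s le_s.
  exact: (idem_short (size s) le_s (in_tuple s)).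
apply: (associative_of_cons _ _ F_rcons F_idem) => a.
elim/last_ind => [|y z IHy]; first exact: F_letter.
(* The chain is F(ayz) = F(F(ay)z) = F(F(aF(y))z) = F(aF(F(y)z)) = F(aF(yz)). The third equality is
   (c), and its length bound holds because aF(y)z has length at most m+2. *)
rewrite -cats1 -cat_cons F_rcons IHy (F_swap a (F y) z).
  by rewrite -F_rcons.
by rewrite /= size_cat addn1 !ltnS hF.
Qed.
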